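(* Let $I\subseteq[d]$ be nonempty. Let $h_j\in L^\infty(J_j)$ for $j=1,\ldots,d$, and define $$\varphi(\omega):=\prod_{j=1}^dh_j(\omega_j),\qquad\omega\in S.$$ For each $j$, let $\bar h_j:=\frac1{\ell_j}\int_{J_j}h_j(t)\,dt$. Then: (i) For every $i\in[d]$, $\Pi_i\varphi=\bar h_i\prod_{j\ne i}h_j$, and $$\mathcal P_I\varphi=\left(\prod_{i\in I}(h_i-\bar h_i)\right)\left(\prod_{j\notin I}h_j\right)$$ (each factor $h_j$ being evaluated at $\omega_j$). In particular, if $\bar h_i=0$ for every $i\in I$, then $\mathcal P_I\varphi=\varphi$ and $\mathcal R_I\varphi=0$. (ii) $$\Lambda_{\mathrm{mix}}^I(\varphi)=\left(\prod_{i\in I}\|h_i\|_{L^1(J_i)}\right)\left(\prod_{j\notin I}\|h_j\|_{L^\infty(J_j)}\right).$$ (iii) $$\Lambda_{\mathrm{sl}}^I(\varphi)=\max_{i\in I}\left\{\|h_i\|_{L^1(J_i)}\prod_{j\ne i}\|h_j\|_{L^\infty(J_j)}\right\}.$$ (iv) If $f_j\in L^1(J_j)$ and $f(\omega)=\prod_{j=1}^df_j(\omega_j)$, then $$\int_S\varphi(\omega)f(\omega)\,d\omega=\prod_{j=1}^d\int_{J_j}h_j(t)f_j(t)\,dt.$$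
   Context: $d\ge 1$, $[d]=\{1,\dots,d\}$, $S=\prod_{j=1}^dJ_j$, $J_j=[a_j,b_j]$ with $a_j<b_j$, $\ell_j=b_j-a_j$. For $I\subseteq[d]$ write $\omega_I=(\omega_i)_{i\in I}$, $\omega_{-I}=(\omega_j)_{j\notin I}$, $S_I=\prod_{i\in I}J_i$, $S_{-I}=\prod_{j\notin I}J_j$ (a singleton if $I=[d]$), and $-i$ for $-\{i\}$. $(\Pi_i\varphi)(\omega)=\frac1{\ell_i}\int_{a_i}^{b_i}\varphi(\omega_{-i},t)\,dt$ ($t$ inserted in coordinate $i$); these operators commute. $\mathcal P_I=\prod_{i\in I}(\mathrm{Id}-\Pi_i)$, $\mathcal R_I=\mathrm{Id}-\mathcal P_I$. Envelopes: $$\Lambda_{\mathrm{sl}}^I(\varphi)=\max_{i\in I}\operatorname*{ess\,sup}_{\omega_{-i}\in S_{-i}}\int_{a_i}^{b_i}|\varphi(\omega_{-i},t)|\,dt,\qquad \Lambda_{\mathrm{mix}}^I(\varphi)=\operatorname*{ess\,sup}_{\omega_{-I}\in S_{-I}}\int_{S_I}|\varphi(\omega_{-I},t_I)|\,dt_I.$$ *)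

(* Defs.v *)
From HB Require Import structures.
From mathcomp Require Import all_boot all_order all_algebra.
From mathcomp Require Import all_classical all_reals all_analysis.
From mathcomp Require Import ess_sup_inf.
Set Implicit Arguments.
Unset Strict Implicit.
Unset Printing Implicit Defensive.
Import Order.TTheory GRing.Theory Num.Theory.
Import numFieldNormedType.Exports.
Local Open Scope classical_set_scope.
Local Open Scope ring_scope.

(* Lebesgue measure on R^n, with R^n := n.-tuple R carrying the library's     *)
(* product sigma-algebra: the image of lebesgue_measure \x lebesgue_tuple n   *)
(* under (t, u) |-> t :: u, starting from the unit mass on the one-point      *)
(* space R^0 (see lebesgue_tuple_rect).                                       *)
Section cons_measure.
Context {R : realType} {n : nat}.
Variable mu : {sigma_finite_measure set (n.-tuple (measurableTypeR R)) -> \bar R}.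

Let RR := measurableTypeR R.

Definition cons_pair (x : RR * n.-tuple RR) : n.+1.-tuple RR :=
  [tuple of x.1 :: x.2].

Lemma measurable_cons_pair : measurable_fun setT cons_pair.
Proof. by apply: measurable_cons. Qed.

Definition cons_measure : set (n.+1.-tuple RR) -> \bar R :=
  pushforward (lebesgue_measure \x mu)%E cons_pair.

Let cons_measure0 : cons_measure set0 = 0%E.
Proof. by rewrite /cons_measure /pushforward preimage_set0 measure0. Qed.

Let cons_measure_ge0 A : (0 <= cons_measure A)%E.
Proof. by rewrite /cons_measure /pushforward; exact: (measure_ge0 (lebesgue_measure \x mu)%E). Qed.

Let cons_measure_sigma_additive : semi_sigma_additive cons_measure.
Proof.
move=> F mF tF mUF; rewrite /cons_measure /pushforward preimage_bigcup.
apply: measure_semi_sigma_additive.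
- by move=> k; rewrite -[X in measurable X]setTI; exact: measurable_cons_pair.
- apply/trivIsetP => /= i j _ _ ij; rewrite -preimage_setI.
  by move/trivIsetP : tF => /(_ _ _ _ _ ij) ->//; rewrite preimage_set0.
- rewrite -preimage_bigcup -[X in measurable X]setTI.
  exact: measurable_cons_pair.
Qed.

HB.instance Definition _ := isMeasure.Build _ _ _ cons_measure
  cons_measure0 cons_measure_ge0 cons_measure_sigma_additive.

Lemma measurable_uncons :
  measurable_fun setT
    (fun x : n.+1.-tuple RR => (thead x, [tuple of behead x])).
Proof.
apply/measurable_fun_pair; first exact: measurable_tnth.
exact: measurable_behead.
Qed.

Lemma preimage_cons_pair (A : set (RR * n.-tuple RR)) :
  cons_pair @^-1` ((fun x => (thead x, [tuple of behead x])) @^-1` A) = A.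
Proof.
rewrite -comp_preimage [X in X @^-1` _](_ : _ = id)//; apply/funext => -[x t] /=.
by rewrite theadE; congr pair; exact/val_inj.
Qed.

Let cons_measure_sigma_finite : sigma_finite setT cons_measure.
Proof.
have /sigma_finiteP[F [TF ndF Foo]] := sigma_finiteT (@lebesgue_measure R).
have /sigma_finiteP[G [TG ndG Goo]] := sigma_finiteT mu.
pose u (x : n.+1.-tuple RR) := (thead x, [tuple of behead x]).
exists (fun k => u @^-1` (F k `*` G k)).
  rewrite -preimage_bigcup -[LHS](preimage_setT u); congr (_ @^-1` _).
  rewrite -setXTT TF TG predeqE => -[x y]; split.
    move=> [/= [k _ Fkx] [l _ Gly]]; exists (maxn k l) => //; split.
    - by move: x Fkx; exact/subsetPset/ndF/leq_maxl.
    - by move: y Gly; exact/subsetPset/ndG/leq_maxr.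
  by move=> [k _ []/= ? ?]; split; exists k.
move=> k; have [? ?] := Foo k; have [? ?] := Goo k; split.
  rewrite -[X in measurable X]setTI; apply: measurable_uncons => //.
  exact: measurableX.
rewrite /cons_measure /pushforward preimage_cons_pair product_measure1E//.
by rewrite lte_mul_pinfty// ge0_fin_numE.
Qed.

HB.instance Definition _ := Measure_isSigmaFinite.Build _ _ _ cons_measure
  cons_measure_sigma_finite.

End cons_measure.

Fixpoint lebesgue_tuple (R : realType) (n : nat) :
    {sigma_finite_measure set (n.-tuple (measurableTypeR R)) -> \bar R} :=
  match n with
  | 0 => \d_([tuple] : 0.-tuple (measurableTypeR R))
  | m.+1 => cons_measure (lebesgue_tuple R m)
  end.

Lemma measurable_rect (R : realType) n (A : 'I_n -> set (measurableTypeR R)) :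
  (forall k, measurable (A k)) ->
  measurable [set u : n.-tuple (measurableTypeR R) | forall k, A k (tnth u k)].
Proof.
move=> mA.
rewrite [X in measurable X](_ : _ =
    \big[setI/setT]_(k < n) ((fun u : n.-tuple (measurableTypeR R) => tnth u k) @^-1` A k)).
  apply: bigsetI_measurable => k _.
  by rewrite -[X in measurable X]setTI; apply: measurable_tnth.
apply/seteqP; split=> [u Au|u].
  by elim/big_ind: _ => // k _; exact: Au.
by move=> + k; rewrite (bigD1 k)//= => -[].
Qed.

Lemma lebesgue_tuple_rect (R : realType) n (A : 'I_n -> set (measurableTypeR R)) :
  (forall k, measurable (A k)) ->
  lebesgue_tuple R n [set u | forall k, A k (tnth u k)] =
  (\prod_(k < n) lebesgue_measure (A k))%E.
Proof.
elim: n A => [|n IH] A mA.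
  by rewrite big_ord0 /= diracE mem_set// => -[].
rewrite big_ord_recl -(IH (fun k => A (lift ord0 k)))//.
rewrite -product_measure1E//; last first.
  exact: (@measurable_rect _ _ (fun k => A (lift ord0 k))).
congr ((_ \x _)%E _); apply/seteqP; split=> -[x t] /=.
- move=> Axt; split; first exact: (Axt ord0).
  by move=> k; have := Axt (lift ord0 k); rewrite tnthS.
- move=> [Ax At] k; have [->//|k0] := eqVneq k ord0.
  by case: (unliftP ord0 k) k0 => [l ->|->]; rewrite ?eqxx// tnthS.
Qed.

Section boxes.
Context {R : realType}.

Definition box n (a b : 'I_n -> R) : set (n.-tuple (measurableTypeR R)) :=
  [set u | forall k, tnth u k \in `[a k, b k]].

Lemma measurable_box n (a b : 'I_n -> R) : measurable (box a b).
Proof.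
apply: (@measurable_rect _ _ (fun k => `[a k, b k]%classic)) => k.
exact: measurable_itv.
Qed.

(* The library's ess_sup and Lnorm range over the whole space, so essential   *)
(* suprema and norms over an interval or a box are taken with respect to      *)
(* Lebesgue measure restricted to it.                                         *)
Definition leb_itv (x y : R) :=
  mrestr (@lebesgue_measure R) (measurable_itv `[x, y]).

Definition leb_box n (a b : 'I_n -> R) :=
  mrestr (lebesgue_tuple R n) (measurable_box a b).

(* Representatives of L^oo([x, y]); the values of h off [x, y] are irrelevant. *)
Definition in_Linfty (x y : R) (h : R -> R) :=
  measurable_fun `[x, y] h /\ finite_norm (leb_itv x y) +oo%E h.

End boxes.

Section envelopes.
Context {R : realType} {d : nat}.
Implicit Types (a b : 'I_d -> R) (I : {set 'I_d}) (i : 'I_d).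
Implicit Type phi : d.-tuple R -> R.

(* The coordinates in I, in increasing order, index the factors of S_I; so    *)
(* S_I is box (coords I a) (coords I b), and likewise S_{-I} with ~: I.       *)
Definition coords I (a : 'I_d -> R) : 'I_#|I| -> R := fun k => a (enum_val k).
Arguments coords I a : clear implicits.

(* (v, u) |-> the point whose coordinates outside I are listed by v and whose *)
(* coordinates in I are listed by u.                                          *)
Definition glue I (v u : seq R) : d.-tuple R :=
  [tuple if j \in I then u`_(index j (enum I)) else v`_(index j (enum (~: I)))
  | j < d].

Definition replace (w : d.-tuple R) i (t : R) : d.-tuple R :=
  [tuple if j == i then t else tnth w j | j < d].

Definition avg a b i phi : d.-tuple R -> R := fun w =>
  (b i - a i)^-1 * \int[lebesgue_measure]_(t in `[a i, b i]) phi (replace w i t).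

(* The factors commute (a.e., by Fubini); they are composed here in the        *)
(* order of the enumeration of I.                                             *)
Definition projP a b I : (d.-tuple R -> R) -> (d.-tuple R -> R) :=
  \big[comp/id]_(i in I) (fun phi => phi \- avg a b i phi).

Definition projR a b I phi : d.-tuple R -> R := phi \- projP a b I phi.

Definition Lambda_sl a b I phi : \bar R :=
  \big[maxe/-oo%E]_(i in I)
    ess_sup
      (leb_box (coords (~: [set i]%SET) a) (coords (~: [set i]%SET) b))
      (fun v => \int[lebesgue_measure]_(t in `[a i, b i])
                  `|phi (glue [set i]%SET v [:: t])|%:E)%E.

Definition Lambda_mix a b I phi : \bar R :=
  ess_sup (leb_box (coords (~: I) a) (coords (~: I) b))
    (fun v => \int[lebesgue_tuple R #|I|]_(u in box (coords I a) (coords I b))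
                `|phi (glue I v u)|%:E)%E.

End envelopes.

(* Main.v *)
Require Import Defs.
From HB Require Import structures.
From mathcomp Require Import all_boot all_order all_algebra.
From mathcomp Require Import all_classical all_reals all_analysis.
From mathcomp Require Import measurable_realfun ess_sup_inf.
From mathcomp Require Import lra.
Set Implicit Arguments.
Unset Strict Implicit.
Unset Printing Implicit Defensive.
Import Order.TTheory GRing.Theory Num.Theory.
Import numFieldNormedType.Exports.
Local Open Scope classical_set_scope.
Local Open Scope ring_scope.

(** Every clause reduces to the fact that the measure, the integral and the
    essential supremum of a product taken over a box factor coordinate by
    coordinate.

    Integration: Lebesgue measure on n-tuples is built by adding one coordinate
    at a time, so Fubini and induction on n give the integral of a product of
    one-variable functions ([integral_tuple_prod]); cutting each factor off
    outside its interval transfers this to boxes ([integral_box_prod]).  With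
    factors h_j f_j, integrable because h_j is essentially bounded, this is the
    pairing formula.

    Essential suprema: for nonnegative factors g_k with essential suprema M_k,
    the product is at most the product of the M_k off a finite union of null
    cylinders.  Conversely, for c_k < M_k the sets {g_k > c_k} have positive
    measure, hence so does their product, and there the product of the g_k is at
    least that of the c_k; letting c_k increase to M_k gives equality
    ([ess_sup_prod]).

    Envelopes: freezing the coordinates outside I turns the slice integral of
    |phi| into the constant given by the L^1 norms over I times the product of
    the remaining |h_j|, for every value of the frozen coordinates; the
    essential supremum of that product is then a product of L^oo norms
    ([Lambda_mix_prod], [Lambda_sl_prod]).

    Averages: averaging in coordinate i replaces the i-th factor by its mean, so
    Id - Pi_i replaces h_i by h_i minus its mean and keeps the product form;
    iterating over I gives the formula for P_I ([projP_prod]). *)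

(** * Integration against a restricted measure *)

Section restricted_measure.
Import HBNNSimple.

(** The function f is arbitrary because representatives of classes on an interval
    are arbitrary outside it.  For measurable functions the part of the
    integral outside D vanishes; in general, both sides are suprema over simple
    functions, and a simple function below f may be cut off outside D. *)
Lemma integral_mrestr d (T : measurableType d) (R : realType)
    (mu : {measure set T -> \bar R}) (D : set T) (mD : measurable D)
    (f : T -> \bar R) : (forall x, 0 <= f x)%E ->
  (\int[mrestr mu mD]_x f x = \int[mu]_(x in D) f x)%E.
Proof.
move=> f0.
have integral_meas (g : T -> \bar R) : measurable_fun setT g -> (forall x, 0 <= g x)%E ->
    (\int[mrestr mu mD]_x g x = \int[mu]_(x in D) g x)%E.
  move=> mg g0; rewrite -(setUv D) ge0_integral_setU ?setUv//; first last.
  - exact/disj_setPCl.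
  - exact: measurableC.
  rewrite [X in (_ + X)%E]null_set_integral ?adde0//.
  - apply: eq_measure_integral => A mA AD.
    by rewrite /= /mrestr setIidl.
  - exact: measurableC.
  - exact: measurable_funTS.
  - by rewrite /= /mrestr setICl measure0.
have mh (h : {nnsfun T >-> R}) : sintegral (mrestr mu mD) h = sintegral mu (h \_ D).
  rewrite -integral_nnsfun// -integral_meas//.
  - by rewrite integral_nnsfun// patch_setT.
  - exact/measurable_EFinP.
  - by move=> x; rewrite lee_fin.
pose fD := f \_ D.
have fD0 x : (0 <= fD x)%E by rewrite /fD/patch; case: ifP.
rewrite [RHS]integral_mkcond; apply/eqP; rewrite eq_le; apply/andP; split.
- rewrite [leLHS]ge0_integralTE// [leRHS]ge0_integralTE//.
  apply: ge_ereal_sup => _ [h /= hf <-]; rewrite mh mrestrict.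
  apply: ereal_sup_ubound; exists (proj_nnsfun h mD) => // x.
  rewrite -mrestrict /patch; case: ifP => // _; exact: hf.
- rewrite [leLHS]ge0_integralTE// [leRHS]ge0_integralTE//.
  apply: ge_ereal_sup => _ [h /= hf <-].
  apply: ereal_sup_ubound; exists h => [x /=|].
    by apply: le_trans (hf x) _; rewrite /patch; case: ifP.
  (* h lies between 0 and a function vanishing off D, so h already vanishes there. *)
  rewrite mh; apply: eq_sintegral => x; rewrite /patch; case: ifPn => // xD.
  apply/esym/eqP; rewrite eq_le; apply/andP; split.
    by have := hf x; rewrite /patch (negbTE xD) lee_fin.
  exact: fun_ge0.
Qed.

End restricted_measure.

(** * Integrals of products *)

Section product_integral.
Context d1 d2 (T1 : measurableType d1) (T2 : measurableType d2) (R : realType).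
Variables (m1 : {sigma_finite_measure set T1 -> \bar R})
          (m2 : {sigma_finite_measure set T2 -> \bar R}).
Variables (f : T1 -> R) (g : T2 -> R).
Hypotheses (intf : m1.-integrable setT (EFin \o f))
           (intg : m2.-integrable setT (EFin \o g)).
Local Open Scope ereal_scope.

Lemma integrable_tensor :
  (m1 \x m2).-integrable setT (fun z => (f z.1 * g z.2)%:E).
Proof.
have /integrableP[/measurable_EFinP mf foo] := intf.
have /integrableP[/measurable_EFinP mg goo] := intg.
apply/integrable12ltyP.
  apply/measurable_EFinP; apply: measurable_funM.
    exact: (measurableT_comp mf).
  exact: (measurableT_comp mg).
have -> : (fun x => \int[m2]_y `|(f x * g y)%:E|) =
          (fun x => `|(f x)%:E| * \int[m2]_y `|(g y)%:E|).
  apply/funext => x; rewrite -ge0_integralZl//=.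
  - by apply: eq_integral => y _; rewrite normrM EFinM.
  - by apply/measurable_EFinP; exact: measurableT_comp.
rewrite ge0_integralZr//=.
- by rewrite lte_mul_pinfty// ?integral_ge0// ge0_fin_numE// integral_ge0.
- by apply/measurable_EFinP; exact: measurableT_comp.
- exact: integral_ge0.
Qed.

Lemma integral_tensor :
  \int[m1 \x m2]_z (f z.1 * g z.2)%:E =
  (\int[m1]_x (f x)%:E) * (\int[m2]_y (g y)%:E).
Proof.
rewrite -(integral12_prod_meas1 integrable_tensor)/=.
have fing : \int[m2]_y (g y)%:E \is a fin_num by exact: integrable_fin_num.
rewrite -(fineK fing) -integralZr//; apply: eq_integral => x _.
by rewrite fineK// -integralZl.
Qed.

End product_integral.

Definition tuple_prod (R : realType) n (g : 'I_n -> R -> R)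
    (u : n.-tuple (measurableTypeR R)) : R :=
  \prod_(k < n) g k (tnth u k).

Section product_tuple.
Context {R : realType}.
Local Notation leb := (@lebesgue_measure R).

Lemma measurable_tuple_prod n (g : 'I_n -> R -> R) :
  (forall k, measurable_fun setT (g k)) -> measurable_fun setT (tuple_prod g).
Proof.
move=> mg; apply: measurable_prod => k _.
exact: (measurableT_comp (mg k) (@measurable_tnth _ _ _ k)).
Qed.

Lemma tuple_prod_cons n (g : 'I_n.+1 -> R -> R) x t :
  tuple_prod g (cons_pair (x, t)) = g ord0 x * tuple_prod (fun k => g (lift ord0 k)) t.
Proof.
rewrite /tuple_prod big_ord_recl; congr (_ * _).
by apply: eq_bigr => k _; rewrite tnthS.
Qed.

(** The measure on (n+1)-tuples is the image of a product measure, and along that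
    map a product function becomes a tensor product; integrability is carried
    through the induction because Fubini requires it. *)
Lemma integral_tuple_prod n (g : 'I_n -> R -> R) :
  (forall k, leb.-integrable setT (EFin \o g k)) ->
  (lebesgue_tuple R n).-integrable setT (EFin \o tuple_prod g) /\
  (\int[lebesgue_tuple R n]_u (tuple_prod g u)%:E
     = \prod_(k < n) \int[leb]_t (g k t)%:E)%E.
Proof.
elim: n g => [|n IH] g ig.
  have -> : tuple_prod g = cst 1 by apply/funext => u; rewrite /tuple_prod big_ord0.
  split.
    apply: integrableS measurableT measurableT _ _ => //.
    exact: finite_measure_integrable_cst.
  rewrite big_ord0; apply: etrans (integral_cst (lebesgue_tuple R 0) measurableT 1%E) _.
  by rewrite mul1e; exact: diracT.
have [iG eG] := IH (fun k => g (lift ord0 k)) (fun k => ig _).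
have mg : measurable_fun setT (EFin \o tuple_prod g).
  apply/measurable_EFinP; apply: measurable_tuple_prod => k.
  by have /integrableP[/measurable_EFinP] := ig k.
have iT := integrable_tensor (ig ord0) iG.
have eT := integral_tensor (ig ord0) iG.
have E : (EFin \o tuple_prod g) \o cons_pair =
   (fun z => (g ord0 z.1 * tuple_prod (fun k => g (lift ord0 k)) z.2)%:E).
  by apply/funext => -[x t] /=; rewrite tuple_prod_cons.
rewrite -E in iT eT.
split.
  exact: (integrable_pushforward (@measurable_cons_pair R n) mg iT measurableT).
have mc := @measurable_cons_pair R n.
have := integral_pushforward mc mg iT measurableT.
by rewrite preimage_setT eT eG big_ord_recl => /= <-.
Qed.

End product_tuple.

Section box_prod.
Context {R : realType} {n : nat}.
Variables (a b : 'I_n -> R) (g : 'I_n -> R -> R).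
Hypothesis ig : forall k, lebesgue_measure.-integrable `[a k, b k] (EFin \o g k).
Let g' k := g k \_ `[a k, b k].

Let restrict_tuple_prod : tuple_prod g \_ (box a b) = tuple_prod g'.
Proof.
apply/funext => u; rewrite /patch /tuple_prod /g'; case: ifPn => [/set_mem ub|].
  apply: eq_bigr => k _; rewrite /patch mem_set//.
  exact: (ub k).
rewrite notin_setE => /existsNP[k uk].
by rewrite (bigD1 k)//= /patch memNset ?mul0r.
Qed.

Let ig' k : lebesgue_measure.-integrable setT (EFin \o g' k).
Proof.
rewrite -restrict_EFin.
have mI : measurable (`[a k, b k]%classic : set (measurableTypeR R)).
  exact: measurable_itv.
have [H _] := integrable_mkcond (mu := @lebesgue_measure R) (EFin \o g k) mI.
exact: (H (ig k)).
Qed.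

Lemma integrable_box_prod : (lebesgue_tuple R n).-integrable (box a b)
  (EFin \o tuple_prod g).
Proof.
apply/integrable_mkcond; first exact: measurable_box.
rewrite restrict_EFin restrict_tuple_prod.
by have [] := integral_tuple_prod ig'.
Qed.

Lemma integral_box_prod :
  (\int[lebesgue_tuple R n]_(u in box a b) (tuple_prod g u)%:E =
   \prod_(k < n) \int[lebesgue_measure]_(t in `[a k, b k]) (g k t)%:E)%E.
Proof.
rewrite integral_mkcond restrict_EFin restrict_tuple_prod.
have [_ ->] := integral_tuple_prod ig'.
by apply: eq_bigr => k _; rewrite [RHS]integral_mkcond restrict_EFin.
Qed.

End box_prod.

(** * Essential suprema of products *)

(** The cylinder over a null subset of one side of the box is a rectangle with a
    null side. *)
Lemma ae_tuple1 (R : realType) n (a b : 'I_n -> R) k (P : R -> Prop) :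
  (\forall t \ae leb_itv (a k) (b k), P t) ->
  \forall u \ae leb_box a b, P (tnth u k).
Proof.
move=> [N [mN N0 NP]].
exists [set u : n.-tuple (measurableTypeR R) | N (tnth u k)]; split.
- by rewrite -[X in measurable X]setTI; apply: measurable_tnth.
- rewrite /leb_box/= /mrestr.
  pose A i : set (measurableTypeR R) :=
    if i == k then N `&` `[a k, b k] else `[a i, b i]%classic.
  rewrite (_ : _ `&` _ = [set u | forall i, A i (tnth u i)]); last first.
    apply/seteqP; split => u; rewrite /box/A/=.
      by move=> [Nu bu] i; case: eqP => [->|_]; [split => //; exact: bu|exact: bu].
    move=> Au; split; first by have := Au k; rewrite eqxx => -[].
    by move=> i; have := Au i; case: eqP => [->[]|].
  rewrite lebesgue_tuple_rect.
    rewrite (bigD1 k)//= /A eqxx.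
    by move: N0; rewrite /leb_itv/= /mrestr => ->; rewrite mul0e.
  move=> i; rewrite /A; case: ifP => _; last exact: measurable_itv.
  by apply: measurableI => //; exact: measurable_itv.
- by move=> u /= nP; exact: NP.
Qed.

Lemma leb_box_gt0 (R : realType) n (a b : 'I_n -> R) :
  (forall k, a k < b k) -> (0 < leb_box a b setT)%E.
Proof.
move=> ab; rewrite /leb_box/= /mrestr setTI.
rewrite (@lebesgue_tuple_rect _ _ (fun k => `[a k, b k]%classic)); last first.
  by move=> k; exact: measurable_itv.
under eq_bigr do rewrite lebesgue_measure_itv/= lte_fin ab EFinN -EFinB.
by rewrite prodEFin lte_fin prodr_gt0// => k _; rewrite subr_gt0.
Qed.

Lemma leb_itv_gt0 (R : realType) (x y : R) : x < y -> (0 < leb_itv x y setT)%E.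
Proof.
move=> xy; rewrite /leb_itv/= /mrestr setTI lebesgue_measure_itv/= lte_fin xy.
by rewrite EFinN -EFinB lte_fin subr_gt0.
Qed.

Lemma bernoulli_inequality (R : realFieldType) (e : R) n :
  0 <= e <= 1 -> 1 - e *+ n <= (1 - e) ^+ n.
Proof.
move=> /andP[e0 e1]; elim: n => [|n IH]; first by rewrite mulr0n subr0 expr0.
rewrite exprS; apply: le_trans (ler_wpM2l _ IH); rewrite ?subr_ge0//.
by rewrite mulrSr; have := mulr_ge0 e0 (mulrn_wge0 n e0); nra.
Qed.

Section ess_sup_prod.
Context {R : realType} {n : nat}.
Variables (a b : 'I_n -> R) (ab : forall k, a k < b k).
Variables (g : 'I_n -> R -> R) (M : 'I_n -> R).
Hypotheses (g0 : forall k t, 0 <= g k t)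
  (mg : forall k, measurable_fun `[a k, b k] (g k))
  (gM : forall k, ess_sup (leb_itv (a k) (b k)) (EFin \o g k) = (M k)%:E).

Let M0 k : 0 <= M k.
Proof.
rewrite -lee_fin -gM; apply: ess_sup_ger; first exact: leb_itv_gt0.
by move=> t; rewrite lee_fin.
Qed.

Local Notation L := (ess_sup (leb_box a b) (EFin \o tuple_prod g)).

Lemma le_ess_sup_prod : (L <= (\prod_(k < n) M k)%:E)%E.
Proof.
apply/ess_supP.
have H : \forall u \ae leb_box a b, forall k, g k (tnth u k) <= M k.
  apply: filter_forall => k; apply: (@ae_tuple1 _ _ _ _ k (fun t => g k t <= M k)).
  have /ess_supP :
    (ess_sup (leb_itv (a k) (b k)) (EFin \o g k) <= (M k)%:E)%E by rewrite gM.
  by apply: filterS => t; rewrite /= lee_fin.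
have F : Filter (almost_everywhere (leb_box a b)).
  exact: ae_filter_ringOfSetsType.
apply: (@filterS _ _ F _ _ _ H) => {}u {}H; rewrite lee_fin.
by apply: ler_prod => k _; rewrite g0 H.
Qed.

(** If the supremum were smaller, the product of the sets {g_k > c_k}, on which
    the product of the g_k is at least that of the c_k, would be null; but each of
    its sides has positive measure since c_k < M_k. *)
Lemma ess_sup_prod_ge (c : 'I_n -> R) :
  (forall k, 0 <= c k < M k) -> ((\prod_(k < n) c k)%:E <= L)%E.
Proof.
move=> cM; rewrite leNgt; apply/negP => Lc.
pose A k := `[a k, b k] `&` [set t | c k < g k t].
have mA k : measurable (A k : set (measurableTypeR R)).
  have -> : A k = `[a k, b k] `&` (g k @^-1` `]c k, +oo[).
    by apply/seteqP; split => t [? /=]; rewrite ?in_itv/= ?andbT => ?;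
      split => //=; rewrite in_itv/= andbT.
  by apply: mg; exact: measurable_itv.
have A0 k : (0 < lebesgue_measure (A k))%E.
  rewrite lt_neqAle measure_ge0 andbT eq_sym; apply/negP => /eqP A0.
  have : (ess_sup (leb_itv (a k) (b k)) (EFin \o g k) <= (c k)%:E)%E.
    apply/ess_supP.
    exists (A k `|` ~` `[a k, b k]); split.
    - apply: measurableU; first exact: mA.
      by apply: measurableC; exact: measurable_itv.
    - by rewrite /leb_itv/= /mrestr setIUl setICl setU0 setIAC setIid.
    - move=> t /= /negP; rewrite lee_fin -ltNge => ct.
      by have [tab|] := pselect (`[a k, b k]%classic t); [left|right].
  by rewrite gM lee_fin leNgt; have /andP[_ ->] := cM k.
have [N [mN N0 NP]] := ess_sup_ge (leb_box a b) (EFin \o tuple_prod g).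
have : (0 < leb_box a b N)%E; last first.
  by rewrite (_ : leb_box a b N = 0%E) ?ltxx//; exact: N0.
apply: (@lt_le_trans _ _ (leb_box a b [set u | forall k, A k (tnth u k)])).
  rewrite /leb_box/= /mrestr setIidl; last by move=> u Au k; have [] := Au k.
  rewrite (lebesgue_tuple_rect mA).
  by elim/big_ind : _ => // *; exact: mule_gt0.
apply: le_measure; rewrite ?inE//; first exact: measurable_rect.
move=> u Au; apply: NP => /= gL.
have := le_lt_trans gL Lc; rewrite lte_fin ltNge => /negP; apply.
apply: ler_prod => k _; have /andP[-> _] /= := cM k.
by have [_ /ltW] := Au k.
Qed.

Lemma ess_sup_prod : L = (\prod_(k < n) M k)%:E.
Proof.
apply/eqP; rewrite eq_le le_ess_sup_prod/=.
have L0 : (0 <= L)%E.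
  apply: ess_sup_ger; first exact: leb_box_gt0.
  by move=> u; rewrite lee_fin prodr_ge0.
(* If some M_k vanishes there is no admissible c_k, but then the product is 0. *)
have [/forallP Mgt0|] := boolP [forall k, 0 < M k]; last first.
  move=> /forallPn[k]; rewrite -leNgt => Mk.
  have /eqP Mk0 : M k == 0 by rewrite eq_le Mk M0.
  by rewrite (bigD1 k)//= Mk0 mul0r.
have P0 : 0 < \prod_(k < n) M k by rewrite prodr_gt0.
have Lfin : L \is a fin_num.
  by rewrite ge0_fin_numE// (le_lt_trans le_ess_sup_prod) ?ltry.
rewrite -(fineK Lfin) lee_fin; apply/ler_addgt0Pr => e e0.
set P := \prod_(k < n) M k in P0 *.
(* With c_k = (1 - q) M_k the lower bound is (1 - q)^n P >= P - q n P, and q is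
   chosen so that q n P <= e; using n.+1 covers n = 0. *)
pose q := Num.min 1 (e / (P *+ n.+1)).
have q0 : 0 < q by rewrite lt_min ltr01/= divr_gt0// pmulrn_lgt0.
have q1 : q <= 1 by rewrite ge_min lexx.
have : ((\prod_(k < n) ((1 - q) * M k))%:E <= L)%E.
  apply: ess_sup_prod_ge => k; rewrite mulr_ge0 ?subr_ge0//=.
  by rewrite gtr_pMl// ltrBlDr ltrDl.
rewrite big_split/= prodr_const card_ord -(fineK Lfin) lee_fin => PL.
have qe : q * (P *+ n.+1) <= e.
  by rewrite -ler_pdivlMr ?pmulrn_lgt0// ge_min lexx orbT.
have /(ler_wpM2r (ltW P0)) : 1 - q *+ n <= (1 - q) ^+ n.
  by apply: bernoulli_inequality; rewrite (ltW q0).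
move=> /le_trans/(_ PL); rewrite mulrBl mul1r lerBlDr => /le_trans; apply.
rewrite lerD2l (le_trans _ qe)// mulrnAl -mulrnAr ler_pM2l// mulrS.
by rewrite lerDr ltW.
Qed.

End ess_sup_prod.

(** * Bounded functions on an interval *)

Section Linfty.
Context {R : realType}.
Variables (x y : R) (xy : x < y).
Local Notation leb := (@lebesgue_measure R).

Lemma Lnormy_itvE (h : R -> R) :
  ('N[leb_itv x y]_+oo[EFin \o h] =
   ess_sup (leb_itv x y) (EFin \o (fun t => `|h t|%R)))%E.
Proof. by rewrite unlock leb_itv_gt0. Qed.

Lemma Lnorm1_itvE (h : R -> R) :
  ('N[leb_itv x y]_1[EFin \o h] = \int[leb]_(t in `[x, y]) `|h t|%:E)%E.
Proof. by rewrite Lnorm1 integral_mrestr. Qed.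

Lemma Lnormy_fin_num (h : R -> R) : in_Linfty x y h ->
  ('N[leb_itv x y]_+oo[EFin \o h])%E \is a fin_num.
Proof. by move=> [_ hoo]; rewrite ge0_fin_numE// Lnorm_ge0. Qed.

Lemma in_Linfty_ae_bounded (h : R -> R) : in_Linfty x y h ->
  exists2 M : R, 0 <= M & \forall t \ae leb, `[x, y]%classic t -> `|h t| <= M.
Proof.
move=> hh; have hfin := Lnormy_fin_num hh.
exists (fine ('N[leb_itv x y]_+oo[EFin \o h])%E).
  by rewrite fine_ge0// Lnorm_ge0.
have [N [mN N0 NP]] := ess_sup_ge (leb_itv x y) (EFin \o (fun t => `|h t|%R)).
exists (N `&` `[x, y]); split => //.
  by apply: measurableI => //; exact: measurable_itv.
move=> t /= /not_implyP[txy ht]; split => //; apply: NP => /=.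
by rewrite -Lnormy_itvE -(fineK hfin) lee_fin.
Qed.

Lemma integrable_Linfty_mul (h f : R -> R) : in_Linfty x y h ->
  leb.-integrable `[x, y] (EFin \o f) ->
  leb.-integrable `[x, y] (fun t => (h t * f t)%:E).
Proof.
move=> hh /integrableP[/measurable_EFinP mf foo].
have [M M0 hM] := in_Linfty_ae_bounded hh; have [mh _] := hh.
have mhf : measurable_fun `[x, y] (fun t => h t * f t) by exact: measurable_funM.
apply/integrableP; split; first exact/measurable_EFinP.
apply: (@le_lt_trans _ _ (\int[leb]_(t in `[x, y]) (M%:E * `|(f t)%:E|))%E).
  apply: ae_ge0_le_integral => //.
  - by apply/measurable_EFinP; exact: measurableT_comp.
  - by move=> t _; rewrite mule_ge0.
  - by apply: measurable_funeM; apply/measurable_EFinP; exact: measurableT_comp.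
  - have F : Filter (almost_everywhere leb) by exact: ae_filter_ringOfSetsType.
    apply: (@filterS _ _ F _ _ _ hM) => t + txy => /(_ txy) htM /=.
    by rewrite lee_fin normrM ler_wpM2r.
rewrite ge0_integralZl//; last by apply/measurable_EFinP; exact: measurableT_comp.
by rewrite lte_mul_pinfty.
Qed.

Lemma integrable_Linfty (h : R -> R) : in_Linfty x y h ->
  leb.-integrable `[x, y] (EFin \o h).
Proof.
move=> hh; have /(integrable_Linfty_mul hh) :
    leb.-integrable `[x, y] (EFin \o cst 1).
  apply: measurable_bounded_integrable => //.
    by rewrite /= lebesgue_measure_itv/= lte_fin xy -EFinB ltry.
  exact: bounded_cst.
by congr integrable; apply/funext => t; rewrite /= mulr1.
Qed.

End Linfty.

(** * Envelopes of products *)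

Section slices.
Context {R : realType} {d : nat}.
Variables (a b : 'I_d -> R) (ab : forall j, a j < b j) (h : 'I_d -> R -> R).
Hypothesis hh : forall j, in_Linfty (a j) (b j) (h j).
Local Notation norm1 j := ('N[leb_itv (a j) (b j)]_1[EFin \o h j])%E.
Local Notation normoo j := ('N[leb_itv (a j) (b j)]_+oo[EFin \o h j])%E.

Lemma prod_glue (J : {set 'I_d}) (v u : seq R) :
  \prod_(j < d) h j (tnth (Defs.glue J v u) j) =
  (\prod_(j in J) h j u`_(index j (enum J))) *
  (\prod_(k < #|~: J|) h (enum_val k) v`_k).
Proof.
rewrite (bigID (mem J))/=; congr (_ * _).
  by apply: eq_bigr => j jJ; rewrite tnth_mktuple jJ.
rewrite (eq_bigl (mem (~: J)))/=; last by move=> j; rewrite !inE.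
rewrite big_enum_val/=; apply: eq_bigr => k _.
have := enum_valP k; rewrite finset.in_setC => /negbTE kJ; rewrite tnth_mktuple kJ.
by rewrite {2}(enum_val_nth (enum_val k)) index_uniq ?enum_uniq// -cardE.
Qed.

Lemma norm1_fin_num j : norm1 j \is a fin_num.
Proof.
rewrite ge0_fin_numE ?Lnorm_ge0// Lnorm1_itvE.
by have /integrableP[] := integrable_Linfty (ab j) (hh j).
Qed.

(** The constant c stands for the slice integral over the other coordinates. *)
Lemma ess_sup_slice (J : {set 'I_d}) (c : R) : 0 <= c ->
  ess_sup (leb_box (@coords R d J a) (@coords R d J b))
    (fun v : #|J|.-tuple (measurableTypeR R) =>
       (c * \prod_(k < #|J|) `|h (enum_val k) (tnth v k)|)%:E) =
  (c%:E * \prod_(j in J) normoo j)%E.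
Proof.
move=> c0.
have abJ (k : 'I_#|J|) : @coords R d J a k < @coords R d J b k by exact: ab.
rewrite (ess_suprZl (fun v : #|J|.-tuple (measurableTypeR R) =>
  \prod_(k < #|J|) `|h (enum_val k) (tnth v k)|) (leb_box_gt0 abJ) c0).
congr (_ * _)%E.
pose M (k : 'I_#|J|) := fine (normoo (enum_val k)).
rewrite (ess_sup_prod abJ (g := fun k t => `|h (enum_val k) t|) (M := M)) //.
- rewrite -prodEFin [RHS]big_enum_val/=; apply: eq_bigr => k _.
  by rewrite fineK// Lnormy_fin_num.
- move=> k; have [mh _] := hh (enum_val k); exact: measurableT_comp.
- by move=> k; rewrite fineK ?Lnormy_fin_num// Lnormy_itvE.
Qed.

Lemma integrable_normr_Linfty j :
  lebesgue_measure.-integrable `[a j, b j] (EFin \o (fun t => `|h j t|)).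
Proof.
exact: (integrable_abse (integrable_Linfty (ab j) (hh j))).
Qed.

Lemma Lambda_mix_prod (I : {set 'I_d}) :
  Lambda_mix a b I (fun w => \prod_(j < d) h j (tnth w j)) =
  ((\prod_(i in I) norm1 i) * (\prod_(j | j \notin I) normoo j))%E.
Proof.
(* The L^1 factor is a finite constant, which is passed to ess_sup_slice as c. *)
have N1 : (\prod_(i in I) norm1 i)%E = (fine (\prod_(i in I) norm1 i)%E)%:E.
  by rewrite fineK//; apply: prode_fin_num => i _; exact: norm1_fin_num.
rewrite N1 [X in (_ * X)%E](eq_bigl (mem (~: I)))/=; last by move=> j; rewrite !inE.
rewrite -ess_sup_slice; last first.
  by apply: fine_ge0; apply: prode_ge0 => i _; exact: Lnorm_ge0.
rewrite /Lambda_mix; congr ess_sup; apply/funext => v.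
pose c := \prod_(k < #|~: I|) `|h (enum_val k) (tnth v k)|.
have ih (k : 'I_#|I|) := integrable_normr_Linfty (enum_val k).
transitivity (\int[lebesgue_tuple R #|I|]_(u in
      box (@coords R d I a) (@coords R d I b))
    (c%:E * (\prod_(k < #|I|) `|h (enum_val k) (tnth u k)|)%:E))%E.
  apply: eq_integral => u _.
  rewrite -EFinM prod_glue normrM !normr_prod mulrC; congr (_ * _)%:E.
    by apply: eq_bigr => k _; rewrite (tnth_nth 0).
  (* The k-th element of I has index k in the enumeration that glue uses. *)
  rewrite [LHS]big_enum_val/=; apply: eq_bigr => k _; rewrite (tnth_nth 0).
  by rewrite {2}(enum_val_nth (enum_val k)) index_uniq ?enum_uniq// -cardE.
rewrite integralZl//; last 2 first.
- exact: measurable_box.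
- exact: (integrable_box_prod (a := @coords R d I a)
    (b := @coords R d I b) (g := fun k t => `|h (enum_val k) t|)).
rewrite (integral_box_prod (a := @coords R d I a)
    (b := @coords R d I b) (g := fun k t => `|h (enum_val k) t|))//.
rewrite mulrC EFinM -N1; congr (_ * _)%E.
by rewrite [RHS]big_enum_val/=; apply: eq_bigr => k _; rewrite Lnorm1_itvE.
Qed.

Lemma Lambda_sl_prod (I : {set 'I_d}) :
  Lambda_sl a b I (fun w => \prod_(j < d) h j (tnth w j)) =
  \big[maxe/-oo%E]_(i in I) (norm1 i * \prod_(j | j != i) normoo j)%E.
Proof.
apply: eq_bigr => i _.
rewrite -(fineK (norm1_fin_num i)).
rewrite [X in (_ * X)%E](eq_bigl (mem (~: [set i]%SET)))/=; last first.
  by move=> j; rewrite !inE.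
rewrite -ess_sup_slice; last by rewrite fine_ge0// Lnorm_ge0.
congr ess_sup; apply/funext => v.
pose c := \prod_(k < #|~: [set i]%SET|) `|h (enum_val k) (tnth v k)|.
transitivity (\int[lebesgue_measure]_(t in `[a i, b i]) (c%:E * `|h i t|%:E))%E.
  apply: eq_integral => t _.
  rewrite -EFinM prod_glue big_set1 enum_set1/= eqxx/= normrM normr_prod mulrC.
  by congr (_ * _)%:E; apply: eq_bigr => k _; rewrite (tnth_nth 0).
rewrite integralZl//; last exact: integrable_normr_Linfty.
by rewrite mulrC EFinM fineK ?norm1_fin_num// Lnorm1_itvE.
Qed.

End slices.

(** * Averages and projections of products *)

Section averages.
Context {R : realType} {d : nat}.
Variables (a b : 'I_d -> R).
Local Notation mean j g :=
  ((b j - a j)^-1 * \int[lebesgue_measure]_(t in `[a j, b j]) g t).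

Lemma tnth_replace (w : d.-tuple R) i t j :
  tnth (replace w i t) j = if j == i then t else tnth w j.
Proof. exact: tnth_mktuple. Qed.

Lemma replace_box (w : d.-tuple R) i t :
  box a b w -> `[a i, b i]%classic t -> box a b (replace w i t).
Proof.
by move=> bw abt j; rewrite tnth_replace; case: eqP => [->|_]; [exact: abt|exact: bw].
Qed.

(** Assuming the product form on the box alone is what allows iteration:
    partially projected functions are known only there, and averaging over a side
    stays in the box. *)
Lemma avg_prod (psi : d.-tuple R -> R) (g : 'I_d -> R -> R) i :
  (forall w, box a b w -> psi w = \prod_(j < d) g j (tnth w j)) ->
  lebesgue_measure.-integrable `[a i, b i] (EFin \o g i) ->
  forall w, box a b w ->
    avg a b i psi w = mean i (g i) * \prod_(j < d | j != i) g j (tnth w j).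
Proof.
move=> psiE ig w bw; rewrite /avg -mulrA; congr (_ * _).
rewrite -RintegralZr//; apply: eq_Rintegral => t /set_mem abt.
rewrite psiE; last exact: replace_box.
rewrite (bigD1 i)//= tnth_replace eqxx; congr (_ * _).
by apply: eq_bigr => j /negbTE ji; rewrite tnth_replace ji.
Qed.

(** By induction along the enumeration of the coordinates: after the coordinates
    of a duplicate-free list have been processed, the function is still a product
    on the box whose factors outside the list are the original ones, so the next
    operator again replaces one factor h_i by h_i minus its mean. *)
Lemma projP_prod (h : 'I_d -> R -> R) (I : {set 'I_d}) :
  (forall j, lebesgue_measure.-integrable `[a j, b j] (EFin \o h j)) ->
  forall w, box a b w ->
  projP a b I (fun w => \prod_(j < d) h j (tnth w j)) w =
  (\prod_(i in I) (h i (tnth w i) - mean i (h i))) *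
  (\prod_(j | j \notin I) h j (tnth w j)).
Proof.
move=> ih w bw.
pose phi (w : d.-tuple R) := \prod_(j < d) h j (tnth w j).
pose g (s : seq 'I_d) j t :=
  if (j \in s) && (j \in I) then h j t - mean j (h j) else h j t.
suff H s : uniq s -> forall w, box a b w ->
    (\big[comp/id]_(i <- s | i \in I) (fun phi => phi \- avg a b i phi)) phi w =
    \prod_(j < d) g s j (tnth w j).
  rewrite /projP H//; last exact: index_enum_uniq.
  rewrite (bigID (mem I))/=; congr (_ * _); apply: eq_bigr => j.
    by move=> jI; rewrite /g mem_index_enum jI.
  by move=> /negbTE jI; rewrite /g jI andbF.
elim: s => [_ v bv|i s IH /= /andP[si us] v bv].
  by rewrite big_nil; apply: eq_bigr => j _; rewrite /g in_nil.
have gE j t : j != i -> g (i :: s) j t = g s j t.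
  by move=> /negbTE ji; rewrite /g in_cons ji.
rewrite big_cons; case: ifPn => iI; last first.
  rewrite IH//; apply: eq_bigr => j _; have [->|ji] := eqVneq j i.
    by rewrite /g (negbTE iI) !andbF.
  by rewrite gE.
have gi : g s i = h i by apply/funext => t; rewrite /g (negbTE si).
rewrite /= (avg_prod (g := g s) (i := i) (IH us) _ bv); last by rewrite gi.
rewrite IH// gi (bigD1 i)//= [RHS](bigD1 i)//= gi -mulrBl; congr (_ * _).
  by rewrite /g mem_head iI.
by apply: eq_bigr => j ji; rewrite gE.
Qed.

End averages.

(** * The proposition *)

Theorem propositionA1 (R : realType) (d : nat) (hd : (1 <= d)%N)
    (a b : 'I_d -> R) (hab : forall j, a j < b j)
    (I : {set 'I_d}) (hI : I != finset.set0)
    (h : 'I_d -> R -> R) (hh : forall j, in_Linfty (a j) (b j) (h j)) :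
  let S := box a b in
  let phi := fun w : d.-tuple R => \prod_(j < d) h j (tnth w j) in
  let hbar := fun j : 'I_d =>
    (b j - a j)^-1 * \int[lebesgue_measure]_(t in `[a j, b j]) h j t in
  let norm1 := fun j : 'I_d => ('N[leb_itv (a j) (b j)]_1[EFin \o h j])%E in
  let normoo := fun j : 'I_d => ('N[leb_itv (a j) (b j)]_+oo[EFin \o h j])%E in
  [/\ (* (i) *)
      [/\ forall i w, S w ->
            avg a b i phi w = hbar i * \prod_(j < d | j != i) h j (tnth w j),
          forall w, S w ->
            projP a b I phi w =
            (\prod_(i in I) (h i (tnth w i) - hbar i)) *
            (\prod_(j | j \notin I) h j (tnth w j))
        & (forall i, i \in I -> hbar i = 0) ->
            forall w, S w -> projP a b I phi w = phi w /\ projR a b I phi w = 0],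
      (* (ii) *)
      Lambda_mix a b I phi =
        ((\prod_(i in I) norm1 i) * (\prod_(j | j \notin I) normoo j))%E,
      (* (iii) *)
      Lambda_sl a b I phi =
        \big[maxe/-oo%E]_(i in I) (norm1 i * \prod_(j | j != i) normoo j)%E
    & (* (iv) *)
      forall f : 'I_d -> R -> R,
        (forall j, lebesgue_measure.-integrable `[a j, b j] (EFin \o f j)) ->
        (\int[lebesgue_tuple R d]_(w in S)
            (phi w * \prod_(j < d) f j (tnth w j))%:E =
         \prod_(j < d) \int[lebesgue_measure]_(t in `[a j, b j])
            (h j t * f j t)%:E)%E].
Proof.
have ih j := integrable_Linfty (hab j) (hh j).
move=> S phi hbar norm1 normoo; split.
- split.
  + by move=> i w Sw; exact: (avg_prod (g := h)).
  + by move=> w Sw; exact: projP_prod.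
  + move=> hbar0 w Sw.
    have E : projP a b I phi w = phi w.
      rewrite (projP_prod _ ih)// [RHS](bigID (mem I))/=; congr (_ * _).
      by apply: eq_bigr => i iI; have := hbar0 i iI; rewrite /hbar => ->; rewrite subr0.
    by split=> //; rewrite /projR /= E subrr.
- exact: Lambda_mix_prod.
- exact: Lambda_sl_prod.
- move=> f intf.
  rewrite -(integral_box_prod (g := fun j t => h j t * f j t)).
    by apply: eq_integral => w _; rewrite -big_split.
  by move=> j; exact: integrable_Linfty_mul.
Qed.
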